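(* Let $\mathcal{X}\subset\mathbb{R}^d$ be a compact action set containing $0$, let $\|\cdot\|$ be a norm on $\mathbb{R}^d$ with dual norm $\|\cdot\|_\star$, and let $\mathrm{Alg}$ be a parametric ETC-type algorithm for $\mathcal{X}$ with expected exploration time bound $B$ and expected commit error bound $C$. For $c\in\mathbb{R}^d$, let $\mathcal{A}_c$ be the algorithm obtained by applying the translation reduction with vector $c$ to $\mathrm{Alg}(2\sigma^2, T/2)$. Then for any linear bandit problem on $c+\mathcal{X}$ with parameter $\theta$ and independent, centered, $\sigma^2$-subgaussian noise, $$R_T(\mathcal{A}_c, c+\mathcal{X},\theta) \le 2\Big(\max_{x,y\in\mathcal{X}}\|x-y\|\Big)\|\theta\|_\star\, B(\theta,2\sigma^2,T/2) + T\, C(\theta,2\sigma^2,T/2).$$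
   Context: Linear bandit on an action set $\mathcal{S}$: at each $t=1,\dots,T$ the learner picks $x_t\in\mathcal{S}$ based on past observations and observes $y_t=x_t^\top\theta+z_t$ with $z_t$ independent, centered, $\sigma^2$-subgaussian ($\mathbb{E}[e^{\lambda z_t}]\le e^{\lambda^2\sigma^2/2}$ for all $\lambda$). $R_T(\mathcal{A},\mathcal{S},\theta) := \mathbb{E}[\sum_{t=1}^T (x^\star_{\mathcal{S}}(\theta)-x_t)^\top\theta]$ with $x^\star_{\mathcal{S}}(\theta)\in\arg\max_{x\in\mathcal{S}}x^\top\theta$. An algorithm is ETC-type if there is a stopping time $T_{\mathrm{commit}}$ such that for every $t>T_{\mathrm{commit}}$ it plays $x_t = x_{\mathrm{commit}} := x_{T_{\mathrm{commit}}+1}$. A parametric ETC-type algorithm $\mathrm{Alg}$ maps a variance proxy $s^2$ and horizon $H$ to an ETC-type algorithm $\mathrm{Alg}(s^2,H)$ on $\mathcal{X}$; it has expected exploration time bound $B$ and expected commit error bound $C$ if for every $\theta, s^2, H$ and every linear bandit on $\mathcal{X}$ with parameter $\theta$ and $s^2$-subgaussian noise, $\mathbb{E}[T_{\mathrm{commit}}(\mathrm{Alg}(s^2,H))]\le B(\theta,s^2,H)$ and $\mathbb{E}[\theta^\top(x^\star_{\mathcal{X}}(\theta)-x_{\mathrm{commit}}(\mathrm{Alg}(s^2,H)))]\le C(\theta,s^2,H)$. Translation reduction with vector $c$ applied to an ETC-type algorithm $\mathcal{A}$ on $\mathcal{X}$: for each round $t\le T_{\mathrm{commit}}(\mathcal{A})$,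 receive $\tilde x_t\in\mathcal{X}$ from $\mathcal{A}$, play $c$ at time $2t-1$ and $c+\tilde x_t$ at time $2t$, and give $y_{2t}-y_{2t-1}$ (equal to $\theta^\top\tilde x_t + z_{2t}-z_{2t-1}$) to $\mathcal{A}$ as the reward for $\tilde x_t$; afterwards play $c+x_{\mathrm{commit}}(\mathcal{A})$ until time $T$. *)

(* Defs.v *)
From mathcomp Require Import all_boot all_order all_algebra.
From mathcomp Require Import all_classical all_reals all_analysis.
Set Implicit Arguments. Unset Strict Implicit. Unset Printing Implicit Defensive.
Import Order.TTheory GRing.Theory Num.Theory numFieldNormedType.Exports.
Local Open Scope classical_set_scope.
Local Open Scope ring_scope.

Section Bandits.
Variables (R : realType) (d : nat).

Definition dotv (u v : 'rV[R]_d) : R := (u *m v^T) 0 0.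

Definition is_norm (N : 'rV[R]_d -> R) : Prop :=
  [/\ forall x y, N (x + y) <= N x + N y,
      forall (a : R) x, N (a *: x) = `|a| * N x &
      forall x, N x = 0 -> x = 0].

Definition dual_norm (N : 'rV[R]_d -> R) (theta : 'rV[R]_d) : R :=
  sup [set dotv x theta | x in [set x | N x <= 1]].

(* max_{x,y in X} ||x - y||  (a max for compact nonempty X) *)
Definition diam (N : 'rV[R]_d -> R) (X : set 'rV[R]_d) : R :=
  sup [set r | exists x y, [/\ X x, X y & r = N (x - y)]].

Definition opt_value (S : set 'rV[R]_d) (theta : 'rV[R]_d) : R :=
  sup [set dotv x theta | x in S].

(* A (deterministic) bandit policy: [pol k h] is the action played at time
   k+1 (0-based index k), given the observations h 0, ..., h (k-1)
   (h i = y_{i+1}); entries h i with i >= k are always 0. *)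
Definition Policy := nat -> (nat -> R) -> 'rV[R]_d.

Fixpoint hist (Omega : Type) (pol : Policy) (theta : 'rV[R]_d)
    (z : nat -> Omega -> R) (w : Omega) (k : nat) : nat -> R :=
  match k with
  | 0 => fun _ => 0
  | k'.+1 => let h := hist pol theta z w k' in
             fun i => if i == k' then dotv (pol k' h) theta + z k' w else h i
  end.

Definition action (Omega : Type) (pol : Policy) (theta : 'rV[R]_d)
    (z : nat -> Omega -> R) (w : Omega) (k : nat) : 'rV[R]_d :=
  pol k (hist pol theta z w k).

(* An ETC-type algorithm: a policy together with its commit rule:
   T_commit = min { t | etc_stop t (observations y_1..y_t) }. *)
Record ETCAlg := MkETCAlg {
  etc_act : Policy ;
  etc_stop : nat -> (nat -> R) -> bool }.

Definition stopped (Omega : Type) (A : ETCAlg) theta (z : nat -> Omega -> R)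
  (w : Omega) : pred nat :=
  fun t => etc_stop A t (hist (etc_act A) theta z w t).

Definition commit_time (Omega : Type) (A : ETCAlg) theta
  (z : nat -> Omega -> R) (w : Omega) : option nat :=
  match pselect (exists t, stopped A theta z w t) with
  | left H => Some (ex_minn H)
  | right _ => None
  end.

Definition commit_time_ext (Omega : Type) (A : ETCAlg) theta
  (z : nat -> Omega -> R) (w : Omega) : \bar R :=
  match commit_time A theta z w with
  | Some n => (n%:R)%:E
  | None => +oo%E
  end.

(* x_commit = x_{T_commit + 1} (arbitrary on the event T_commit = oo) *)
Definition commit_action (Omega : Type) (A : ETCAlg) theta
  (z : nat -> Omega -> R) (w : Omega) : 'rV[R]_d :=
  match commit_time A theta z w with
  | Some n => action (etc_act A) theta z w n
  | None => action (etc_act A) theta z w 0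
  end.

Definition subgaussian (dO : measure_display) (Omega : measurableType dO)
  (P : probability Omega R) (s2 : R) (X : Omega -> R) : Prop :=
  forall l : R,
    (\int[P]_w (expR (l * X w))%:E <= (expR (l ^+ 2 * s2 / 2))%:E)%E.

Definition centered (dO : measure_display) (Omega : measurableType dO)
  (P : probability Omega R) (X : Omega -> R) : Prop :=
  P.-integrable setT (EFin \o X) /\ (\int[P]_w (X w)%:E = 0)%E.

Definition mutually_independent (dO : measure_display)
  (Omega : measurableType dO) (P : probability Omega R)
  (z : nat -> Omega -> R) : Prop :=
  forall (F : seq nat), uniq F ->
  forall A : nat -> set R, (forall i, measurable (A i)) ->
    P (\bigcap_(i in [set` F]) (z i @^-1` A i)) =
    (\prod_(i <- F) P (z i @^-1` A i))%E.

Definition noise_ok (dO : measure_display) (Omega : measurableType dO)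
  (P : probability Omega R) (s2 : R) (z : nat -> Omega -> R) : Prop :=
  [/\ forall t, measurable_fun setT (z t),
      mutually_independent P z,
      forall t, centered P (z t) &
      forall t, subgaussian P s2 (z t)].

Definition param_measurable (Alg : R -> R -> ETCAlg) : Prop :=
  forall (s2 H : R) (dO : measure_display) (Omega : measurableType dO)
    (theta : 'rV[R]_d) (z : nat -> Omega -> R),
    (forall t, measurable_fun setT (z t)) ->
    forall k,
      (forall i, measurable_fun setT
         (fun w => action (etc_act (Alg s2 H)) theta z w k 0 i)) /\
      measurable [set w | stopped (Alg s2 H) theta z w k].

Definition param_ETC_bounds (X : set 'rV[R]_d) (Alg : R -> R -> ETCAlg)
  (B C : 'rV[R]_d -> R -> R -> R) : Prop :=
  forall (theta : 'rV[R]_d) (s2 H : R) (dO : measure_display)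
    (Omega : measurableType dO) (P : probability Omega R)
    (z : nat -> Omega -> R),
    noise_ok P s2 z ->
    let A := Alg s2 H in
    [/\
        forall w k, X (action (etc_act A) theta z w k),
        forall w n, commit_time A theta z w = Some n ->
          forall k, (n <= k)%N ->
            action (etc_act A) theta z w k = action (etc_act A) theta z w n,
        (\int[P]_w commit_time_ext A theta z w <= (B theta s2 H)%:E)%E &
        (\int[P]_w (opt_value X theta - dotv (commit_action A theta z w) theta)%:E
           <= (C theta s2 H)%:E)%E].

(* reconstruct the first m rewards given to A:  y_{2i} - y_{2i-1} *)
Definition alg_hist_from (h : nat -> R) (m : nat) : nat -> R :=
  fun i => if (i < m)%N then h (2 * i + 1)%N - h (2 * i)%N else 0.

(* translation reduction with vector c applied to A, as a policy:
   at time index k (time k+1), m := k/2 rounds of A are complete. *)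
Definition translate_policy (c : 'rV[R]_d) (A : ETCAlg) : Policy :=
  fun k h =>
    let m := k./2 in
    let j := find (fun j => etc_stop A j (alg_hist_from h j)) (iota 0 m.+1) in
    if (j <= m)%N then c + etc_act A j (alg_hist_from h j) (* committed *)
    else if odd k then c + etc_act A m (alg_hist_from h m)  (* time 2t *)
    else c.                                                 (* time 2t-1 *)

Definition regret (T : nat) (pol : Policy) (S : set 'rV[R]_d)
  (theta : 'rV[R]_d) (dO : measure_display) (Omega : measurableType dO)
  (P : probability Omega R) (z : nat -> Omega -> R) : \bar R :=
  \int[P]_w (\sum_(k < T) (opt_value S theta - dotv (action pol theta z w k) theta))%:E.

End Bandits.

(* Main.v *)
Require Import Defs.
From HB Require Import structures.
From mathcomp Require Import all_boot all_order all_algebra.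
From mathcomp Require Import all_classical all_reals all_analysis.
From mathcomp Require Import measurable_realfun.
From mathcomp Require Import ring lra zify.
Import Order.TTheory GRing.Theory Num.Theory numFieldNormedType.Exports.
Local Open Scope classical_set_scope.
Local Open Scope ring_scope.

(* Playing c and then c + x cancels c: until it commits, the reduction feeds
   the base algorithm exactly the rewards of a bandit on X with noise
   z'_i = z_(2i+1) - z_(2i) (0-based), which is again independent and centered,
   and (2 sigma^2)-subgaussian. Pathwise, each of the at most 2 T_commit
   exploration steps costs at most diam(X) times the dual norm of theta, and
   every later step costs the commit gap; integrating this bound against the
   guarantees B and C gives the theorem. On the event T_commit = +oo the
   pathwise bound holds in the extended reals (with 0 * +oo = 0). *)

(** * Norms and linear rewards *)

Section Norms.
Context {R : realType} {d : nat}.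
Implicit Types (N : 'rV[R]_d -> R) (u v x y theta : 'rV[R]_d) (X : set 'rV[R]_d).

Lemma dotvE u v : dotv u v = \sum_i u 0 i * v 0 i.
Proof. by rewrite /dotv mxE; apply: eq_bigr => i _; rewrite mxE. Qed.

Lemma dotvDl u v w : dotv (u + v) w = dotv u w + dotv v w.
Proof. by rewrite /dotv mulmxDl mxE. Qed.

Lemma dotvZl a u v : dotv (a *: u) v = a * dotv u v.
Proof. by rewrite /dotv -scalemxAl mxE. Qed.

Lemma dot0v v : dotv 0 v = 0.
Proof. by rewrite /dotv mul0mx mxE. Qed.

Lemma dotvBl u v w : dotv (u - v) w = dotv u w - dotv v w.
Proof. by rewrite dotvDl -scaleN1r dotvZl mulN1r. Qed.

Lemma norm_coord x i : `|x 0 i| <= `|x|.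
Proof. by rewrite {2}/Num.norm /= mx_normrE (le_bigmax _ (fun ij => `|x ij.1 ij.2|) (0, i)). Qed.

Lemma dotv_norm_le u v : dotv u v <= `|u| * \sum_i `|v 0 i|.
Proof.
rewrite dotvE mulr_sumr; apply: ler_sum => i _.
by rewrite (le_trans (ler_norm _))// normrM ler_wpM2r// norm_coord.
Qed.

(** Not among the axioms of [is_norm]: it comes from 0 = N(x - x) <= N(x) + N(-x) = 2 N(x). *)
Lemma is_norm_ge0 {N} : is_norm N -> forall x, 0 <= N x.
Proof.
move=> [ND NZ _] x; have := ND x (- x).
rewrite -scaleN1r NZ normrN1 scaleN1r subrr.
by rewrite -(scale0r 0) NZ normr0; lra.
Qed.

(** Expand [x] in the canonical basis and bound each coordinate by the sup norm |x|. *)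
Lemma is_norm_lipschitz {N} : is_norm N ->
  exists2 K, 0 <= K & forall x, N x <= K * `|x|.
Proof.
move=> nN; have [ND NZ _] := nN.
exists (\sum_i N (delta_mx 0 i)); first by apply: sumr_ge0 => i _; exact: is_norm_ge0.
move=> x; rewrite {1}(row_sum_delta x).
apply: (@le_trans _ _ (\sum_i N (x 0 i *: delta_mx 0 i))).
  elim/big_ind2 : _ => //; first by rewrite -(scale0r 0) NZ normr0 mul0r.
  by move=> a b c e ab ce; apply: le_trans (ND _ _) _; exact: lerD.
rewrite mulr_suml; apply: ler_sum => i _.
by rewrite NZ mulrC ler_wpM2l ?is_norm_ge0// norm_coord.
Qed.

Lemma is_norm_continuous {N} : is_norm N -> continuous N.
Proof.
move=> nN; have [ND NZ _] := nN; have [K K0 NK] := is_norm_lipschitz nN.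
(* [K] may be 0, so the division below uses [K + 1]. *)
have K1 : 0 < K + 1 by lra.
move=> x; apply/(@cvgrPdist_le _ _ _ (nbhs x) (nbhs_filter x)) => e e0.
have NB u v : N u - N v <= (K + 1) * `|u - v|.
  have := ND (u - v) v; rewrite subrK => h.
  have := NK (u - v); have := normr_ge0 (u - v); lra.
near=> y; have xy : `|x - y| <= e / (K + 1).
  near: y; apply: cvgr_dist_le; [exact: cvg_id|exact: divr_gt0].
rewrite ler_norml.
have Exy : (K + 1) * `|x - y| <= e by rewrite mulrC -ler_pdivlMr.
have := NB x y; have := NB y x; rewrite distrC; lra.
Unshelve. all: end_near. Qed.

(** [N] attains its minimum on the compact sup-norm unit sphere; definiteness makes it positive and
    homogeneity extends the bound to all [x]. *)
Lemma is_norm_coercive {N} : is_norm N -> exists2 m, 0 < m & forall x, m * `|x| <= N x.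
Proof.
move=> nN; have [ND NZ N0] := nN.
pose S := [set x : 'rV[R]_d | `|x| = 1].
(* When d = 0 the sphere is empty; every vector is then 0 and any positive constant works. *)
have [S0|/set0P S0] := eqVneq S set0.
  exists 1 => // x; have [->|x0] := eqVneq x 0.
    by rewrite normr0 mulr0 is_norm_ge0.
  suff : S (`|x|^-1 *: x) by rewrite S0.
  by rewrite /S /= normrZ normfV normr_id mulVf// normr_eq0.
have cS : compact S.
  apply: bounded_closed_compact.
    by exists 1; split => // M M1 x /= ->; exact: ltW.
  by apply: (@closed_comp _ _ (fun x : 'rV[R]_d => `|x|) [set 1]);
    [move=> x _; exact: norm_continuous|exact: closed_eq].
have [|x0 /set_mem x0S x0min] := compact_EVT_min (f := N) S0 cS.
  exact/continuous_subspaceT/is_norm_continuous.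
have Nx0 : 0 < N x0.
  rewrite lt_neqAle is_norm_ge0// andbT eq_sym; apply/eqP => /N0 x00.
  by move: x0S; rewrite /S /= x00 normr0 => /esym/eqP; rewrite oner_eq0.
exists (N x0) => // x; have [->|xn0] := eqVneq x 0.
  by rewrite normr0 mulr0 is_norm_ge0.
have nx : 0 < `|x| by rewrite normr_gt0.
have : N x0 <= N (`|x|^-1 *: x).
  apply: x0min; apply/mem_set.
  by rewrite /S /= normrZ normfV normr_id mulVf// normr_eq0.
by rewrite NZ normfV normr_id mulrC ler_pdivlMr.
Qed.

(** Coercivity bounds the unit ball of [N] in sup norm. Without an upper bound [sup] would only be a
    default value. *)
Lemma dual_norm_ubound {N} theta : is_norm N ->
  has_ubound [set dotv x theta | x in [set x | N x <= 1]].
Proof.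
move=> /is_norm_coercive[m m0 mN]; exists (m^-1 * \sum_i `|theta 0 i|) => _ [x /= Nx <-].
apply: (le_trans (dotv_norm_le _ _)); rewrite ler_wpM2r ?sumr_ge0//.
by rewrite -[leRHS]mulr1 ler_pdivlMl// (le_trans (mN _)).
Qed.

Lemma dual_norm_ge0 {N} theta : is_norm N -> 0 <= dual_norm N theta.
Proof.
move=> nN; apply: ub_le_sup; first exact: dual_norm_ubound.
have [_ NZ _] := nN.
by exists 0; rewrite ?dot0v//= -(scale0r 0) NZ normr0 mul0r.
Qed.

Lemma dotv_le_dual_norm {N} x theta : is_norm N -> dotv x theta <= N x * dual_norm N theta.
Proof.
move=> nN; have [_ NZ N0] := nN.
have [Nx0|Nx0] := eqVneq (N x) 0; first by rewrite (N0 _ Nx0) dot0v -(N0 _ Nx0) Nx0 mul0r.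
have Nxp : 0 < N x by rewrite lt_neqAle eq_sym Nx0 is_norm_ge0.
rewrite -ler_pdivrMl// -dotvZl; apply: ub_le_sup; first exact: dual_norm_ubound.
exists ((N x)^-1 *: x) => //=.
by rewrite NZ gtr0_norm ?invr_gt0// mulVf.
Qed.

Lemma compact_norm_le X : compact X -> exists M, forall x, X x -> `|x| <= M.
Proof.
move=> /compact_bounded[M [_ XM]]; exists (M + 1) => x Xx.
by apply: XM => //; rewrite ltrDl.
Qed.

(** Compactness bounds [X] in sup norm and the Lipschitz estimate transfers this to [N], so the
    [sup] in [diam] is over a bounded set. *)
Lemma le_diam {N X x y} : is_norm N -> compact X -> X x -> X y -> N (x - y) <= diam N X.
Proof.
move=> nN /compact_norm_le[M XM] Xx Xy; have [K K0 NK] := is_norm_lipschitz nN.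
apply: ub_le_sup; last by exists x, y.
exists (K * (M + M)) => _ [a [b [Xa Xb ->]]].
apply: (le_trans (NK _)); rewrite ler_wpM2l//.
by rewrite (le_trans (ler_normB _ _))// lerD// XM.
Qed.

Lemma dotv_ubound X theta : compact X -> has_ubound [set dotv x theta | x in X].
Proof.
move=> /compact_norm_le[M XM]; exists (M * \sum_i `|theta 0 i|) => _ [x Xx <-].
by rewrite (le_trans (dotv_norm_le _ _))// ler_wpM2r ?sumr_ge0// XM.
Qed.

Lemma le_opt_value {X} theta {x} : compact X -> X x -> dotv x theta <= opt_value X theta.
Proof. by move=> cX Xx; apply: ub_le_sup; [exact: dotv_ubound|exists x]. Qed.

(** Lets the regret of c + x on the translated set be read as the gap of x on [X], since the reward
    of [c] cancels. *)
Lemma opt_value_translate {X} (c theta : 'rV[R]_d) : compact X -> X !=set0 ->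
  opt_value [set (c + x)%R | x in X] theta = dotv c theta + opt_value X theta.
Proof.
move=> cX [x0 Xx0]; apply/eqP; rewrite eq_le; apply/andP; split.
  apply: ge_sup; first by exists (dotv (c + x0) theta), (c + x0) => //; exists x0.
  move=> _ [_ [x Xx <-] <-]; rewrite dotvDl lerD2l; exact: le_opt_value.
rewrite -lerBrDl; apply: ge_sup; first by exists (dotv x0 theta), x0.
move=> _ [x Xx <-]; rewrite lerBrDl -dotvDl; apply: ub_le_sup; last first.
  by exists (c + x) => //; exists x.
have [M XM] := dotv_ubound X theta cX; exists (dotv c theta + M).
by move=> _ [_ [y Xy <-] <-]; rewrite dotvDl lerD2l; apply: XM; exists y.
Qed.

(** The dual norm inequality is applied to y - x for each competitor y. This prices every
    exploration step. *)
Lemma opt_gap_le {N X x} theta : is_norm N -> compact X -> X x ->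
  opt_value X theta - dotv x theta <= diam N X * dual_norm N theta.
Proof.
move=> nN cX Xx; rewrite lerBlDr; apply: ge_sup; first by exists (dotv x theta), x.
move=> _ [y Xy <-]; rewrite -lerBlDr -dotvBl (le_trans (dotv_le_dual_norm _ _ nN))//.
by rewrite ler_wpM2r ?dual_norm_ge0// le_diam.
Qed.

End Norms.

(** * Independence of the paired noise *)

Section Independence.
Context {R : realType} {dO : measure_display} {Omega : measurableType dO}.
Variable P : probability Omega R.

Local Open Scope ereal_scope.

Section Pair.
Variables U V : {mfun Omega >-> R}.
Hypothesis UV : forall A B : set R, measurable A -> measurable B ->
  P ((U @^-1` A) `&` (V @^-1` B)) = P (U @^-1` A) * P (V @^-1` B).

Let UVmap w := (U w, V w).
Let mUV : measurable_fun setT UVmap.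
Proof. exact: measurable_fun_pair. Qed.

(* A law on the plane is determined by its values on rectangles. *)
Lemma joint_law_indep (M : set (R * R)) : measurable M ->
  (distribution P U \x distribution P V) M = pushforward P UVmap M.
Proof.
pose m0 : {measure set (R * R) -> \bar R} := pushforward P UVmap.
pose m' := m0 mUV.
move=> mM; rewrite -/(m' M).
exact: (@product_measure_unique _ _ _ _ _ (distribution P U) (distribution P V) m').
Qed.

(** The law of (U, V) conditioned on [E] agrees with the product law on rectangles, hence on all
    measurable sets of the plane. *)
Lemma indep_event_pair (E : set Omega) :
  measurable E ->
  (forall A B : set R, measurable A -> measurable B ->
    P (E `&` ((U @^-1` A) `&` (V @^-1` B))) = P E * (P (U @^-1` A) * P (V @^-1` B))) ->
  forall M : set (R * R), measurable M ->
    P (E `&` (UVmap @^-1` M)) = P E * P (UVmap @^-1` M).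
Proof.
move=> mE indE M mM; have mUM : measurable (UVmap @^-1` M).
  by rewrite -[X in measurable X]setTI; exact: mUV.
(* Conditioning divides by P(E), so a null event is treated apart; both sides are then 0. *)
have [PE0|PE0] := eqVneq (P E) 0.
  rewrite PE0 mul0e; apply/eqP; rewrite eq_le measure_ge0 andbT -PE0.
  by apply: le_measure; rewrite ?inE//; exact: measurableI.
have PEfin : P E \is a fin_num by exact: fin_num_measure.
have r0 : (0 <= (fine (P E))^-1)%R by rewrite invr_ge0 fine_ge0.
have PEr : P E = (fine (P E))%:E by rewrite fineK.
have rP0 : fine (P E) != 0%R by apply: contra PE0 => /eqP h; rewrite PEr h.
pose m0 : {measure set (R * R) -> \bar R} :=
  mscale (NngNum r0) (pushforward (mrestr P mE) UVmap).
pose m' := m0 mUV.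
have m'E X : m' X = (fine (P E))^-1%:E * P (E `&` UVmap @^-1` X).
  by rewrite /m' /m0 /= /mscale /= /pushforward /mrestr setIC.
rewrite -[P (UVmap @^-1` M)]/(pushforward P UVmap M) -joint_law_indep//.
rewrite (@product_measure_unique _ _ _ _ _ (distribution P U) (distribution P V) m')//.
  by rewrite m'E [X in X * _]PEr muleA -EFinM divff// mul1e.
move=> A B mA mB; rewrite m'E.
rewrite (_ : UVmap @^-1` (A `*` B) = (U @^-1` A) `&` (V @^-1` B))//.
by rewrite indE// muleA [in X in X * _]PEr -EFinM mulVf// mul1e.
Qed.

(** Pushing forward to the plane gives an integral against the product law, where Tonelli separates
    the factors. *)
Lemma ge0_expectation_indep_mul (f g : R -> R) :
  measurable_fun setT f -> measurable_fun setT g ->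
  (forall x, (0 <= f x)%R) -> (forall x, (0 <= g x)%R) ->
  \int[P]_w (f (U w) * g (V w))%:E =
  (\int[P]_w (f (U w))%:E) * (\int[P]_w (g (V w))%:E).
Proof.
move=> mf mg f0 g0.
pose m0 : {measure set (R * R) -> \bar R} := pushforward P UVmap.
pose m' := m0 mUV.
pose h (x : R * R) : \bar R := (f x.1 * g x.2)%:E.
have mh : measurable_fun setT h.
  by apply/measurable_EFinP; apply: measurable_funM; apply: measurableT_comp.
have h0 x : 0 <= h x by rewrite lee_fin mulr_ge0.
transitivity (\int[m']_x h x).
  by rewrite ge0_integral_pushforward.
rewrite (@eq_measure_integral _ _ _ _ (distribution P U \x distribution P V))%E; last first.
  by move=> A mA _; exact: esym (joint_law_indep _ mA).
rewrite fubini_tonelli1//.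
have -> : \int[P]_w (f (U w))%:E = \int[distribution P U]_x (f x)%:E.
  by rewrite ge0_integral_pushforward//; [exact/measurable_EFinP|move=> x _; rewrite lee_fin].
have -> : \int[P]_w (g (V w))%:E = \int[distribution P V]_x (g x)%:E.
  by rewrite ge0_integral_pushforward//; [exact/measurable_EFinP|move=> x _; rewrite lee_fin].
rewrite muleC -ge0_integralZl//; last 3 first.
- exact/measurable_EFinP.
- by move=> x _; rewrite lee_fin.
- by apply: integral_ge0 => x _; rewrite lee_fin.
apply: eq_integral => x _; rewrite /fubini_F /h /=.
under eq_integral do rewrite EFinM.
by rewrite ge0_integralZl_EFin//; [rewrite muleC|move=> y _; rewrite lee_fin|exact/measurable_EFinP].
Qed.

End Pair.
End Independence.

(** * The differenced noise: independence, centering, subgaussianity *)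

Definition pair_noise {R : realType} {Omega : Type} (z : nat -> Omega -> R) : nat -> Omega -> R :=
  fun i w => z (2 * i + 1)%N w - z (2 * i)%N w.

Lemma bigcap_cons {I : choiceType} {T : Type} (i : I) (s : seq I) (F : I -> set T) :
  \bigcap_(j in [set` i :: s]) F j = F i `&` \bigcap_(j in [set` s]) F j.
Proof. by rewrite !bigcap_seq big_cons. Qed.

Section PairNoise.
Context {R : realType} {dO : measure_display} {Omega : measurableType dO}.
Variables (P : probability Omega R) (z : nat -> Omega -> R).
Hypothesis mz : forall t, measurable_fun setT (z t).
Hypothesis iz : mutually_independent P z.

Let Z (a : nat) : {mfun Omega >-> R} := HB.pack (z a) (isMeasurableFun.Build _ _ _ _ (z a) (mz a)).

Lemma indep2 a b (A B : set R) : a != b -> measurable A -> measurable B ->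
  P ((z a @^-1` A) `&` (z b @^-1` B)) = (P (z a @^-1` A) * P (z b @^-1` B))%E.
Proof.
move=> ab mA mB.
have uab : uniq [:: a; b] by rewrite /= inE ab.
have := iz _ uab (fun i => if i == a then A else B).
rewrite !bigcap_cons set_nil bigcap_set0 setIT !big_cons big_nil mule1.
rewrite eqxx (negbTE (_ : b != a)); last by rewrite eq_sym.
by apply => i; case: ifP.
Qed.

Let measurable_subr : measurable_fun setT (fun x : R * R => x.2 - x.1).
Proof. exact: measurable_funB. Qed.

Let even_odd i : (2 * i)%N != (2 * i + 1)%N. Proof. lia. Qed.

Lemma measurable_pair_noise i : measurable_fun setT (pair_noise z i).
Proof. exact: measurable_funB. Qed.

Let measurable_fin_bigcap (y : nat -> Omega -> R) (F : seq nat) (A : nat -> set R) :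
  (forall i, measurable_fun setT (y i)) -> (forall i, measurable (A i)) ->
  measurable (\bigcap_(i in [set` F]) (y i @^-1` A i)).
Proof.
move=> my mA; apply: fin_bigcap_measurable => // i _.
by rewrite -[X in measurable X]setTI; exact: my.
Qed.

(* The second family [G] provides the room needed to split a difference into
   its two noise variables, one index [i] of [F] at a time. *)
Lemma pair_noise_indep_mixed (F G : seq nat) (A B : nat -> set R) :
  uniq F -> uniq G -> (forall g, g \in G -> g./2 \notin F) ->
  (forall i, measurable (A i)) -> (forall i, measurable (B i)) ->
  P ((\bigcap_(i in [set` F]) (pair_noise z i @^-1` A i)) `&`
     (\bigcap_(i in [set` G]) (z i @^-1` B i))) =
  ((\prod_(i <- F) P (pair_noise z i @^-1` A i)) * (\prod_(i <- G) P (z i @^-1` B i)))%E.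
Proof.
move=> + + + mA; elim: F G B => [|i F IH] G B.
  by move=> _ uG _ mB; rewrite set_nil bigcap_set0 setTI big_nil mul1e; exact: iz.
move=> /= /andP[iF uF] uG GF mB.
set E := (\bigcap_(j in [set` F]) (pair_noise z j @^-1` A j)) `&`
  (\bigcap_(j in [set` G]) (z j @^-1` B j)).
have PE : P E = ((\prod_(i <- F) P (pair_noise z i @^-1` A i)) *
    (\prod_(i <- G) P (z i @^-1` B i)))%E.
  by apply: IH => // g /GF; rewrite inE negb_or => /andP[].
have mE : measurable E.
  by apply: measurableI; apply: measurable_fin_bigcap => //; exact: measurable_pair_noise.
rewrite bigcap_cons big_cons -setIA -/E setIC -muleA -PE muleC.
(* The event of the difference at [i] is the preimage of a planar set under the pair of its two
   noise variables, so it suffices that [E] is independent of rectangles in that pair. *)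
apply: (@indep_event_pair _ _ _ P (Z (2 * i)) (Z (2 * i + 1)) _ E mE _
  ((fun x : R * R => x.2 - x.1) @^-1` A i)).
- by move=> A' B' mA' mB'; exact: indep2.
- move=> A' B' mA' mB'; rewrite -indep2// indep2//.
  (* Moving both variables of round [i] into the second family, with [B''] prescribing their events,
     makes the rectangle an instance of the induction hypothesis. *)
  pose B'' j := if j == (2 * i)%N then A' else if j == (2 * i + 1)%N then B' else B j.
  (* Both 2i and 2i + 1 halve to [i], so the hypothesis on [G] keeps them out of [G]. *)
  have iG b : (b < 2)%N -> (2 * i + b)%N \notin G.
    move=> b2; apply/negP => /GF; rewrite inE negb_or => /andP[+ _].
    by apply/negP; rewrite negbK; apply/eqP; lia.
  have i0 : (2 * i)%N \notin G by have := iG 0%N isT; rewrite addn0.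
  have i1 := iG 1%N isT.
  have B0 : B'' (2 * i)%N = A' by rewrite /B'' eqxx.
  have B1 : B'' (2 * i + 1)%N = B' by rewrite /B'' eqxx eq_sym (negbTE (even_odd i)).
  have BG j : j \in G -> B'' j = B j.
    move=> jG; rewrite /B''; case: eqP => [ji|_]; first by rewrite -ji jG in i0.
    by case: eqP => [ji|//]; rewrite -ji jG in i1.
  have := IH ((2 * i)%N :: (2 * i + 1)%N :: G) B'' uF.
  rewrite !bigcap_cons !big_cons B0 B1.
  rewrite (eq_bigcapr (F := fun j => z j @^-1` B'' j) (G := fun j => z j @^-1` B j)); last by move=> j /= jG; rewrite BG.
  rewrite (eq_big_seq (F1 := fun j => P (z j @^-1` B'' j)) (fun j => P (z j @^-1` B j))); last by move=> j jG; rewrite BG.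
  move=> H; rewrite PE.
  rewrite (_ : E `&` _ = (\bigcap_(j in [set` F]) (pair_noise z j @^-1` A j)) `&`
    ((z (2 * i)%N @^-1` A') `&` ((z (2 * i + 1)%N @^-1` B') `&`
      (\bigcap_(j in [set` G]) (z j @^-1` B j))))); last first.
    by rewrite /E -setIA; congr (_ `&` _); rewrite setIC setIA.
  rewrite H.
  + by rewrite -!muleA; congr (_ * _)%E; rewrite [RHS]muleC muleA.
  + by rewrite /= inE negb_or even_odd i0 i1.
  + move=> g; rewrite !inE => /or3P[/eqP->|/eqP->|/GF]; last first.
    * by rewrite inE negb_or => /andP[].
    * by rewrite (_ : (2 * i + 1)./2 = i)%N//; lia.
    * by rewrite (_ : (2 * i)./2 = i)%N//; lia.
  + by move=> j; rewrite /B''; case: ifP => // _; case: ifP.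
- by rewrite -[X in measurable X]setTI; exact: measurable_subr.
Qed.

Lemma pair_noise_indep : mutually_independent P (pair_noise z).
Proof.
move=> F uF A mA; have := @pair_noise_indep_mixed F [::] A A uF isT _ mA mA.
by rewrite set_nil bigcap_set0 setIT big_nil mule1; apply.
Qed.

Lemma pair_noise_centered i :
  (forall t, centered P (z t)) -> centered P (pair_noise z i).
Proof.
move=> cz; have [i1 e1] := cz (2 * i + 1)%N; have [i0 e0] := cz (2 * i)%N.
split.
  rewrite (_ : EFin \o _ = (EFin \o z (2 * i + 1)%N) \- (EFin \o z (2 * i)%N))%E//.
  exact: integrableB.
transitivity (\int[P]_w ((EFin \o z (2 * i + 1)%N) w - (EFin \o z (2 * i)%N) w))%E => //.
by rewrite integralB//= e0 e1 sube0.
Qed.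

(** By independence the moment generating function of the difference is a product of values at l and
    -l; each contributes l^2 s2 / 2 to the exponent, which doubles the proxy. *)
Lemma pair_noise_subgaussian s2 i :
  (forall t, subgaussian P s2 (z t)) -> subgaussian P (2 * s2) (pair_noise z i).
Proof.
move=> sz l.
have -> : (\int[P]_w (expR (l * pair_noise z i w))%:E =
  (\int[P]_w (expR (l * z (2 * i + 1)%N w))%:E) * (\int[P]_w (expR (- l * z (2 * i)%N w))%:E))%E.
  rewrite -(@ge0_expectation_indep_mul _ _ _ P (Z (2 * i + 1)) (Z (2 * i)) _
    (fun x => expR (l * x)) (fun x => expR (- l * x))).
  - by apply: eq_integral => w _; rewrite -expRD /pair_noise; congr (expR _)%:E; rewrite /=; ring.
  - by move=> A B mA mB; apply: indep2 => //; rewrite eq_sym.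
  - by apply: measurableT_comp => //; exact: measurable_funM.
  - by apply: measurableT_comp => //; exact: measurable_funM.
  - by move=> x; exact: expR_ge0.
  - by move=> x; exact: expR_ge0.
apply: (le_trans (lee_pmul _ _ (sz _ l) (sz _ (- l)))).
- by apply: integral_ge0 => w _; rewrite lee_fin expR_ge0.
- by apply: integral_ge0 => w _; rewrite lee_fin expR_ge0.
by rewrite -EFinM -expRD (_ : _ + _ = l ^+ 2 * (2 * s2) / 2)//; field.
Qed.

End PairNoise.

Lemma pair_noise_ok {R : realType} {dO : measure_display} {Omega : measurableType dO}
  {P : probability Omega R} {s2 : R} {z : nat -> Omega -> R} :
  noise_ok P s2 z -> noise_ok P (2 * s2) (pair_noise z).
Proof.
move=> [mz iz cz sz]; split.
- by move=> t; exact: measurable_pair_noise.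
- exact: pair_noise_indep.
- by move=> t; exact: pair_noise_centered.
- by move=> t; exact: pair_noise_subgaussian.
Qed.

(** * Histories under the translation reduction *)

Section History.
Context {R : realType} {d : nat} {Omega : Type}.
Implicit Types (A : ETCAlg R d) (pol : Policy R d) (theta : 'rV[R]_d).
Implicit Types (z : nat -> Omega -> R) (w : Omega).

Lemma hist_lt pol theta z w k i : (i < k)%N ->
  hist pol theta z w k i = dotv (action pol theta z w i) theta + z i w.
Proof.
elim: k => // k IH; rewrite ltnS leq_eqVlt /= => /predU1P[->|ik]; first by rewrite eqxx.
by rewrite (ltn_eqF ik) IH.
Qed.

Lemma hist_ge pol theta z w k i : (k <= i)%N ->
  hist pol theta z w k i = 0.
Proof.
by elim: k => //= k IH ki; rewrite gtn_eqF// IH// ltnW.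
Qed.

Lemma commit_time_SomeP A theta z w n :
  commit_time A theta z w = Some n <-> stopped A theta z w n /\ (forall i, (i < n)%N -> ~~ stopped A theta z w i).
Proof.
rewrite /commit_time; case: pselect => [H|H]; last first.
  by split=> // -[sn _]; exfalso; apply: H; exists n.
case: ex_minnP => m sm mmin; split=> [[<-]|[sn nmin]].
  by split=> // i im; apply: contraL im => /mmin; rewrite leqNgt.
congr Some; apply/eqP; rewrite eqn_leq mmin//= leqNgt; apply/negP => mn.
by have /negP := nmin _ mn.
Qed.

Lemma commit_time_NoneP A theta z w :
  commit_time A theta z w = None <-> (forall i, ~~ stopped A theta z w i).
Proof.
rewrite /commit_time; case: pselect => [H|H]; split=> //.
  by case: H => n sn /(_ n)/negP.
by move=> _ i; apply/negP => si; apply: H; exists i.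
Qed.

End History.

(** * Simulation of the base algorithm by the reduction *)

Section Translate.
Context {R : realType} {d : nat} {Omega : Type}.
Variables (A : ETCAlg R d) (c theta : 'rV[R]_d) (z : nat -> Omega -> R) (w : Omega).

Let z' := pair_noise z.
Let y (k : nat) := hist (translate_policy c A) theta z w k.
Let x := hist (etc_act A) theta z' w.
Let stop := stopped A theta z' w.

(** Strong induction: the actions of round [i] use reconstructed histories of length at most [i],
    already known to be correct; subtracting the reward of [c] then leaves the base reward with
    noise [pair_noise z i]. *)
Lemma alg_hist_translate j k : (forall i, (i < j)%N -> ~~ stop i) ->
  (2 * j <= k)%N -> alg_hist_from (y k) j = x j.
Proof.
elim/ltn_ind: j k => j IH k Hj jk; apply/funext => i; rewrite /alg_hist_from.
(* From index [j] on both histories are 0 by convention, so they agree as functions. *)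
case: ltnP => [ij|ji]; last by rewrite /x hist_ge.
rewrite /y /x !hist_lt; [|lia..].
(* [find] returns i + 1 when no length up to [i] stops, so a false comparison says that the
   reduction still explores at indices 2i and 2i + 1. *)
have nocommit l h : (l = 2 * i \/ l = 2 * i + 1)%N -> h = y l ->
    (find (fun j => etc_stop A j (alg_hist_from h j)) (iota 0 l./2.+1) <= l./2)%N = false.
  move=> Hl ->; have l2 : l./2 = i by lia.
  rewrite l2; apply/negP => Hf.
  have : has (fun j => etc_stop A j (alg_hist_from (y l) j)) (iota 0 i.+1).
    by rewrite has_find size_iota.
  move=> /hasP[a]; rewrite mem_iota add0n /= ltnS => ai.
  rewrite IH; [|lia|by move=> b ba; apply: Hj; lia|lia].
  by apply/negP; apply: Hj; lia.
rewrite /action /translate_policy -/(y _) -/(y _).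
rewrite (nocommit _ (y (2 * i + 1)%N)) ?(nocommit _ (y (2 * i)%N))//; [|by left|by right].
have -> : odd (2 * i + 1) by lia.
have -> : odd (2 * i) = false by lia.
have -> : ((2 * i + 1)./2 = i)%N by lia.
rewrite (IH i)//; [|by move=> b bi; apply: Hj; lia|lia].
by rewrite dotvDl /z' /pair_noise -/z' -/x; ring.
Qed.

Lemma action_translate_explore k : (forall i, (i <= k./2)%N -> ~~ stop i) ->
  action (translate_policy c A) theta z w k =
  if odd k then c + action (etc_act A) theta z' w k./2 else c.
Proof.
move=> Hk; rewrite /action /translate_policy -/(y k).
case: ifP => [Hf|_].
  have /hasP[a] : has (fun j => etc_stop A j (alg_hist_from (y k) j)) (iota 0 k./2.+1).
    by rewrite has_find size_iota.
  rewrite mem_iota add0n /= ltnS => ai.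
  rewrite alg_hist_translate; [|by move=> b ba; apply: Hk; lia|lia].
  by move/negP: (Hk _ ai).
case: ifP => // _; rewrite alg_hist_translate//; last lia.
by move=> i ik; apply: Hk; lia.
Qed.

(** The search covers lengths up to [k./2], while the reconstruction is known to be correct only up
    to [n]; this suffices because [find] returns the first hit, which is [n]. *)
Lemma action_translate_commit n k : (forall i, (i < n)%N -> ~~ stop i) -> stop n ->
  (n <= k./2)%N ->
  action (translate_policy c A) theta z w k = c + action (etc_act A) theta z' w n.
Proof.
move=> Hn sn nk; rewrite /action /translate_policy -/(y k).
set p := fun j => _.
have pn : p n by rewrite /p alg_hist_translate//; lia.
suff -> : find p (iota 0 k./2.+1) = n by rewrite nk alg_hist_translate//; lia.
have -> : (k./2.+1 = n + (k./2 - n).+1)%N by lia.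
rewrite iotaD find_cat ifN.
  by rewrite size_iota add0n /= pn addn0.
rewrite -all_predC; apply/allP => a; rewrite mem_iota add0n /= => an.
rewrite /p alg_hist_translate; [exact: Hn|by move=> b ba; apply: Hn; lia|lia].
Qed.

End Translate.

(** * Regret of the reduction *)

(** The integral of a nonnegative function is a supremum over simple functions below it, so
    monotonicity needs no measurability. This bounds the regret integrand without showing it
    measurable. *)
Lemma ge0_le_integralT {R : realType} {dO : measure_display} {Omega : measurableType dO}
    (mu : {measure set Omega -> \bar R}) (f g : Omega -> \bar R) :
  (forall w, 0 <= f w)%E -> (forall w, f w <= g w)%E ->
  (\int[mu]_w f w <= \int[mu]_w g w)%E.
Proof.
move=> f0 fg; have g0 w : (0 <= g w)%E by exact: le_trans (fg w).
rewrite !ge0_integralTE//; apply: le_ereal_sup => _ [h hf <-].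
by exists h => // w; exact: le_trans (fg w).
Qed.

(** * Measurability of the commit time and of the commit reward *)

Section CommitMeasurable.
Context {R : realType} {d : nat} {dO : measure_display} {Omega : measurableType dO}.
Variables (A : ETCAlg R d) (theta : 'rV[R]_d) (z : nat -> Omega -> R).
Hypothesis mact : forall k i, measurable_fun setT (fun w => action (etc_act A) theta z w k 0 i).
Hypothesis mstop : forall k, measurable [set w | stopped A theta z w k].

Lemma measurable_commit_time_eq o : measurable [set w | commit_time A theta z w = o].
Proof.
have mns k : measurable [set w | ~~ stopped A theta z w k].
  rewrite (_ : mkset _ = ~` [set w | stopped A theta z w k]); first exact: measurableC.
  by apply/seteqP; split=> w /= /negP.
case: o => [n|].
  rewrite (_ : mkset _ = [set w | stopped A theta z w n] `&`
      \bigcap_(i in `I_n) [set w | ~~ stopped A theta z w i]).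
    by apply: measurableI => //; exact: fin_bigcap_measurable.
  apply/seteqP; split=> w /=.
    by move=> /(commit_time_SomeP A theta z w n).
  by move=> H; apply/(commit_time_SomeP A theta z w n).
rewrite (_ : mkset _ = \bigcap_i [set w | ~~ stopped A theta z w i]).
  exact: bigcapT_measurable.
apply/seteqP; split=> w /=.
  by move=> /(commit_time_NoneP A theta z w) H i _; exact: H.
by move=> H; apply/(commit_time_NoneP A theta z w) => i; exact: H.
Qed.

(** The commit time has countably many values, so the space splits into countably many measurable
    level sets, on each of which the function is a fixed [g o]. *)
Lemma measurable_fun_commit_time {d' : measure_display} {T : measurableType d'}
    (g : option nat -> Omega -> T) :
  (forall o, measurable_fun setT (g o)) ->
  measurable_fun setT (fun w => g (commit_time A theta z w) w).
Proof.
(* Enumeration of [option nat] by [nat], with [None] placed at 0. *)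
move=> mg; pose o n := if n is m.+1 then Some m else None.
rewrite (_ : setT = \bigcup_n [set w | commit_time A theta z w = o n]).
  apply/measurable_fun_bigcup => n; first exact: measurable_commit_time_eq.
  apply: (@eq_measurable_fun _ _ _ _ _ (g (o n))); last exact: measurable_funTS.
  by move=> w; rewrite inE /= => ->.
by apply/seteqP; split=> // w _; case E : (commit_time A theta z w) => [n|];
  [exists n.+1|exists 0%N].
Qed.

Lemma measurable_commit_time_ext :
  @measurable_fun _ _ Omega (\bar R) setT (commit_time_ext A theta z).
Proof.
exact: (measurable_fun_commit_time (fun o _ => if o is Some n then (n%:R)%:E else +oo%E)).
Qed.

Lemma measurable_commit_reward :
  measurable_fun setT (fun w => dotv (commit_action A theta z w) theta).
Proof.
pose g o w := dotv (action (etc_act A) theta z w (odflt 0%N o)) theta.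
rewrite (_ : (fun w => _) = fun w => g (commit_time A theta z w) w); last first.
  by apply/funext => w; rewrite /g /commit_action; case: commit_time.
apply: measurable_fun_commit_time => o; rewrite /g.
under eq_fun do rewrite dotvE.
by apply: measurable_sum => i; exact: measurable_funM.
Qed.

End CommitMeasurable.

Lemma sum_ltn_ord (T m : nat) : (\sum_(k < T) (k < m) = minn T m)%N.
Proof. by elim: T => [|T IH]; rewrite ?big_ord0 ?big_ord_recr /= ?IH; lia. Qed.

(** * Pathwise bound on the regret *)

Section PathwiseRegret.
Context {R : realType} {d : nat} {Omega : Type}.
Variables (X : set 'rV[R]_d) (N : 'rV[R]_d -> R) (A : ETCAlg R d).
Variables (c theta : 'rV[R]_d) (z : nat -> Omega -> R) (w : Omega).
Hypotheses (cX : compact X) (X0 : X 0) (nN : is_norm N).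
Hypothesis AX : forall k, X (action (etc_act A) theta (pair_noise z) w k).

Let D := diam N X * dual_norm N theta.
Let gap := opt_value X theta - dotv (commit_action A theta (pair_noise z) w) theta.
Let term k := opt_value [set (c + x)%R | x in X] theta -
  dotv (action (translate_policy c A) theta z w k) theta.

Lemma diam_dual_ge0 : 0 <= D.
Proof.
rewrite mulr_ge0 ?dual_norm_ge0//.
by rewrite (le_trans (is_norm_ge0 nN (0 - 0)))// le_diam.
Qed.

Lemma commit_gap_ge0 : 0 <= gap.
Proof.
rewrite subr_ge0 le_opt_value// /commit_action.
by case: commit_time => [n|]; exact: AX.
Qed.

(** Every exploration action is c + x with x in [X]: odd indices play a translated base action, and
    even ones play [c], for which x = 0 is taken in [X]. *)
Let explore k : (forall i, (i <= k./2)%N -> ~~ stopped A theta (pair_noise z) w i) ->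
  0 <= term k <= D.
Proof.
move=> Hk; rewrite /term opt_value_translate//; last by exists 0.
suff [x Xx ->] : exists2 x, X x & action (translate_policy c A) theta z w k = c + x.
  rewrite dotvDl opprD addrACA subrr add0r subr_ge0.
  by rewrite le_opt_value//= opt_gap_le.
rewrite action_translate_explore//.
case: ifP => _; last by exists 0; rewrite ?addr0.
by exists (action (etc_act A) theta (pair_noise z) w k./2).
Qed.

Let commit n k : commit_time A theta (pair_noise z) w = Some n -> (n <= k./2)%N ->
  term k = gap.
Proof.
move=> Hn nk; have [sn nmin] := (commit_time_SomeP _ _ _ _ _).1 Hn.
rewrite /term opt_value_translate//; last by exists 0.
rewrite (action_translate_commit _ _ _ _ _ n)// dotvDl opprD addrACA subrr add0r.
by rewrite /gap /commit_action Hn.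
Qed.

Lemma translate_regret_ge0 k : 0 <= term k.
Proof.
case E : (commit_time A theta (pair_noise z) w) => [n|].
  have [nk|kn] := leqP n k./2; first by rewrite (commit _ _ E nk) commit_gap_ge0.
  have [_ nmin] := (commit_time_SomeP _ _ _ _ _).1 E.
  by have /andP[] := @explore k (fun i ik => nmin i (leq_ltn_trans ik kn)).
by have /andP[] := @explore k (fun i _ => (commit_time_NoneP _ _ _ _).1 E i).
Qed.

Lemma translate_regret_le T :
  ((\sum_(k < T) term k)%:E <=
   (2 * D)%:E * commit_time_ext A theta (pair_noise z) w + (T%:R)%:E * gap%:E)%E.
Proof.
rewrite /commit_time_ext; case E : (commit_time A theta (pair_noise z) w) => [n|].
  rewrite -!EFinM -EFinD lee_fin.
  (* Exploration happens at k < 2n, that is [k./2] < n. The nonnegative gap is charged at every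
     index, whence the factor [T]. *)
  apply: (@le_trans _ _ (\sum_(k < T) (D * (k < 2 * n)%:R + gap))).
    apply: ler_sum => k _; case: ltnP => nk.
      have [_ nmin] := (commit_time_SomeP _ _ _ _ _).1 E.
      have /andP[_ h] : 0 <= term k <= D by apply: explore => i ik; apply: nmin; lia.
      by rewrite mulr1 (le_trans h)// lerDl commit_gap_ge0.
    by rewrite mulr0 add0r (commit n)//; lia.
  rewrite big_split /= -mulr_sumr -natr_sum sum_ltn_ord sumr_const card_ord.
  rewrite -(mulr_natl gap) lerD2r (_ : 2 * D * n%:R = D * (2 * n)%:R); last first.
    by rewrite natrM mulrA (mulrC D).
  by rewrite ler_wpM2l ?diam_dual_ge0// ler_nat geq_minr.
have H k : 0 <= term k <= D by apply: explore => i _; exact: (commit_time_NoneP _ _ _ _).1 E i.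
have gap0 : (0 <= (T%:R)%:E * gap%:E)%E by rewrite -EFinM lee_fin mulr_ge0// commit_gap_ge0.
(* Without commitment the right side is +oo unless [D] is 0, where 0 * +oo = 0; each term is then at
   most 0. *)
have [D0|D0] := eqVneq D 0.
  rewrite D0 mulr0 mul0e add0e (le_trans _ gap0)// lee_fin.
  by apply: sumr_le0 => k _; rewrite -D0; case/andP: (H k).
rewrite mulr_infty gtr0_sg; last by rewrite mulr_gt0// lt_neqAle eq_sym D0 diam_dual_ge0.
by rewrite mul1e addye ?leey// gt_eqF// (lt_le_trans _ gap0)// ltNy0.
Qed.

End PathwiseRegret.

Theorem theoremB1 (R : realType) (d : nat) (X : set 'rV[R]_d)
  (N : 'rV[R]_d -> R) (Alg : R -> R -> ETCAlg R d)
  (B C : 'rV[R]_d -> R -> R -> R) (sigma2 : R) (T : nat)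
  (c theta : 'rV[R]_d)
  (dO : measure_display) (Omega : measurableType dO)
  (P : probability Omega R) (z : nat -> Omega -> R) :
  compact X -> X 0 -> is_norm N ->
  param_measurable Alg -> param_ETC_bounds X Alg B C ->
  noise_ok P sigma2 z ->
  (regret T (translate_policy c (Alg (2 * sigma2)%R (T%:R / 2)%R))
     [set (c + x)%R | x in X] theta P z
   <= (2 * diam N X * dual_norm N theta * B theta (2 * sigma2)%R (T%:R / 2)%R
       + T%:R * C theta (2 * sigma2)%R (T%:R / 2)%R)%:E)%E.
Proof.
move=> cX X0 nN mAlg bAlg okz; have okz' := pair_noise_ok okz; have [mz' _ _ _] := okz'.
(* The guarantees are instantiated at [pair_noise z], the noise of the bandit on [X] that the
   reduction simulates. *)
have [AX _ hB hC] := bAlg theta _ (T%:R / 2) _ _ _ _ okz'.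
have mA := mAlg (2 * sigma2) (T%:R / 2) _ _ theta _ mz'.
set A := Alg _ _ in AX hB hC mA *.
have mact k := (mA k).1; have mstop k := (mA k).2.
have D0 := diam_dual_ge0 X N theta cX X0 nN.
have gap0 w := commit_gap_ge0 X A theta z w cX (AX w).
have mgap : measurable_fun setT
    (fun w => opt_value X theta - dotv (commit_action A theta (pair_noise z) w) theta).
  by apply: measurable_funB => //; exact: measurable_commit_reward.
have mtau := measurable_commit_time_ext A theta (pair_noise z) mstop.
have tau0 w : (0 <= commit_time_ext A theta (pair_noise z) w)%E.
  by rewrite /commit_time_ext; case: commit_time.
rewrite /regret; apply: (@le_trans _ _ (\int[P]_w
   ((2 * (diam N X * dual_norm N theta))%:E * commit_time_ext A theta (pair_noise z) w +
    (T%:R)%:E * (opt_value X theta - dotv (commit_action A theta (pair_noise z) w) theta)%:E))%E).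
  apply: ge0_le_integralT => w.
    by rewrite lee_fin; apply: sumr_ge0 => k _; exact: translate_regret_ge0 cX X0 nN (AX w) k.
  exact: translate_regret_le.
have D20 : 0 <= 2 * (diam N X * dual_norm N theta) by rewrite mulr_ge0.
(* Unlike the comparison above, additivity asks for measurable summands; [mtau] and [mgap] provide
   them. *)
rewrite ge0_integralD//; last 4 first.
- by move=> w _; rewrite mule_ge0// lee_fin.
- exact: measurable_funeM.
- by move=> w _; rewrite mule_ge0// lee_fin.
- by apply: measurable_funeM; exact/measurable_EFinP.
rewrite !ge0_integralZl_EFin//; last 2 first.
- by move=> w _; rewrite lee_fin.
- exact/measurable_EFinP.
rewrite EFinD; apply: leeD.
  by rewrite -(mulrA 2) [leRHS]EFinM; apply: lee_wpmul2l; rewrite ?lee_fin.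
by rewrite [leRHS]EFinM; apply: lee_wpmul2l; rewrite ?lee_fin.
Qed.
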